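(* The generating function $G_5(x)=\sum_{n\ge0}g_{5,n}x^n$ for Greek key tours on height $5$ grid graphs is $G_5(x)=P(x)/Q(x)$, where $$P(x)=1-3x-13x^2+58x^3+25x^4-162x^5+63x^6+113x^7-61x^8+12x^9-11x^{10}+25x^{11}-17x^{12}+5x^{13}-3x^{14},$$ $$Q(x)=(1+x)(1-11x^2-2x^6)(1-5x+2x^2+8x^3-8x^4+x^5-x^6).$$
   Context: A Greek key tour on the $k\times n$ grid graph ($k$ rows, $n$ columns; vertices are integer points, edges join points at distance $1$) is a directed self-avoiding walk that starts at the upper-left corner vertex and visits every vertex of the grid exactly once. $g_{k,n}$ denotes the number of Greek key tours on the $k\times n$ grid graph, with the convention $g_{k,0}=1$. *)

(* Defs.v *)
From mathcomp Require Import all_boot all_order all_algebra.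

Set Implicit Arguments.
Unset Strict Implicit.
Unset Printing Implicit Defensive.

Import GRing.Theory.

(* ** Greek key tours *)

(* (i, j) is the grid point in row i, counted from the top, and column j,
   counted from the left. *)
Definition vertex (k n : nat) : finType := ('I_k * 'I_n)%type.

(* Distance 1 is stated as squared Euclidean distance 1; `|a - b|%N is the
   absolute difference of integers. *)
Definition adj (k n : nat) : rel (vertex k n) :=
  fun u v => (`|u.1 - v.1| ^ 2 + `|u.2 - v.2| ^ 2 == 1)%N.

Definition upper_left (k n : nat) (v : vertex k n) : bool :=
  (val v.1 == 0%N) && (val v.2 == 0%N).

Definition greek_key_tour (k n : nat) (w : seq (vertex k n)) : bool :=
  if w is v :: w' then
    [&& upper_left v, path (@adj k n) v w'
      & [forall u : vertex k n, count_mem u w == 1%N]]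
  else false.

Lemma greek_key_tour_size (k n : nat) (w : seq (vertex k n)) :
  greek_key_tour w -> size w = (k * n)%N.
Proof.
case: w => // v w' /and3P[_ _ /forallP once].
have w_uniq : uniq (v :: w').
  apply: count_mem_uniq => u; rewrite (eqP (once u)).
  by rewrite -has_pred1 has_count (eqP (once u)).
have := card_uniqP w_uniq; rewrite (eq_card (B := vertex k n)); last first.
  by move=> u; rewrite -has_pred1 has_count (eqP (once u)).
by rewrite card_prod !card_ord.
Qed.

(* By greek_key_tour_size, restricting to tuples of length k * n loses no
   tour. *)
Definition greek_key_number (k n : nat) : nat :=
  if n == 0%N then 1%N
  else #|[set w : (k * n).-tuple (vertex k n) | greek_key_tour w]|.

(* ** Formal power series, as coefficient sequences *)

Local Open Scope ring_scope.

Section PowerSeries.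
Variable F : fieldType.
Implicit Types f g h : nat -> F.

Definition fps_of_poly (p : {poly F}) : nat -> F := fun n => p`_n.

Definition fps_mul f g : nat -> F :=
  fun n => \sum_(i < n.+1) f i * g (n - i)%N.

Fixpoint fps_div_prefix f g (n : nat) : seq F :=
  if n is m.+1 then
    let s := fps_div_prefix f g m in
    rcons s ((f m - \sum_(i < m) s`_i * g (m - i)%N) / g 0%N)
  else [::].

(* f / g by long division; meaningful when g 0 != 0 (see fps_divP). *)
Definition fps_div f g : nat -> F := fun n => (fps_div_prefix f g n.+1)`_n.

Lemma size_fps_div_prefix f g n : size (fps_div_prefix f g n) = n.
Proof. by elim: n => //= n IHn; rewrite size_rcons IHn. Qed.

Lemma nth_fps_div_prefix f g n i :
  (i < n)%N -> (fps_div_prefix f g n)`_i = fps_div f g i.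
Proof.
elim: n => // n IHn; rewrite ltnS leq_eqVlt => /predU1P[-> //|lt_in].
by rewrite /= nth_rcons size_fps_div_prefix lt_in IHn.
Qed.

Lemma fps_divE f g n :
  fps_div f g n =
  (f n - \sum_(i < n) fps_div f g i * g (n - i)%N) / g 0%N.
Proof.
rewrite {1}/fps_div /= nth_rcons size_fps_div_prefix ltnn eqxx.
by under eq_bigr => i _ do rewrite nth_fps_div_prefix //.
Qed.

Lemma fps_divP f g h :
  g 0%N != 0 -> (h =1 fps_div f g) <-> (fps_mul h g =1 f).
Proof.
move=> g0; split=> [hE n | hgE].
  rewrite /fps_mul big_ord_recr /= subnn hE fps_divE divfK // addrC.
  by under eq_bigr => i _ do rewrite hE; rewrite subrK.
elim/ltn_ind=> n IHn; rewrite fps_divE -(hgE n) /fps_mul big_ord_recr /= subnn.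
by under eq_bigr => i _ do rewrite IHn //; rewrite addrC addrK mulfK.
Qed.

End PowerSeries.

Definition greek_key_gf (k : nat) : nat -> rat :=
  fun n => (greek_key_number k n)%:R.

(* Main.v *)
(* Closing a Hamiltonian path through an extra point 0 turns it into a directed
   Hamiltonian cycle.  Deleting a vertex from such a cycle joins its predecessor
   a to its successor b, and the pair (a, b) must stay consecutive: summing over
   (a, b) gives a recursion on the number of vertices.  On the 5 x n grid, deleting
   vertices in column-major order keeps all forced pairs within the next five
   vertices and 0, so only finitely many configurations of forced pairs occur, and
   g_{5,n} is a linear functional of the n-th iterate of a linear map (column).
   The n-th coefficient of Q G_5, for n >= 15, is read off in the same way from
   the orbit of one vector, which an explicit polynomial of degree 18 in this
   linear map annihilates; as the first 18 of these coefficients vanish, so do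
   all of them. *)

From Stdlib Require Import ZArith.
Require Import Defs.
From mathcomp Require Import all_boot all_order all_algebra.
From mathcomp Require Import zify ssrZ ring.
Import GRing.Theory.

Set Implicit Arguments.
Unset Strict Implicit.
Unset Printing Implicit Defensive.

(** * Counting Hamiltonian cycles by deleting vertices *)

Lemma count_sum (U : Type) (P : pred U) (t : seq U) :
  count P t = \sum_(i <- t) P i.
Proof. by elim: t => [|x t /= ->]; rewrite ?big_nil // big_cons. Qed.

Section Hamiltonian.
Variables (T : eqType) (o : T).
Implicit Types (r : rel T) (s p V w : seq T).

(** Each directed Hamiltonian cycle on [o :: V] is cut open at [o], so it is counted once; for empty
    [V] only the loop at [o] is tested. *)
Definition ham r V : nat := count (fun w => path r o (rcons w o)) (permutations V).

(** The path a -> v -> b contracts to an arc from [a] to [b], present whether or not [r a b]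
    held. *)
Definition splice r (a b : T) : rel T :=
  fun x y => if (x == a) || (y == b) then (x == a) && (y == b) else r x y.

Definition insert (v : T) s i := take i s ++ v :: drop i s.

Lemma ham_perm r V V' : perm_eq V V' -> ham r V = ham r V'.
Proof. by move/perm_permutations/permP; apply. Qed.

Lemma permutations_insert v V : v \notin V -> uniq V ->
  perm_eq (permutations (v :: V))
          [seq insert v w i | w <- permutations V, i <- iota 0 (size V).+1].
Proof.
move=> vV uV; apply: uniq_perm; first exact: permutations_uniq.
  apply: allpairs_uniq; rewrite ?permutations_uniq ?iota_uniq //.
  move=> ? ? /allpairsPdep[x [j [xV jV ->]]] /allpairsPdep[y [k [yV kV ->]]] /=.
  have del z l : z \in permutations V -> l \in iota 0 (size V).+1 ->
      index v (insert v z l) = l /\ rem v (insert v z l) = z.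
    rewrite mem_permutations mem_iota /= add0n ltnS => zV lV.
    have vt : v \notin take l z.
      by apply: contra vV => /mem_take; rewrite (perm_mem zV).
    have sl : size (take l z) = l by rewrite size_takel // (perm_size zV).
    rewrite /insert index_cat (negbTE vt) /= eqxx addn0 sl; split=> //.
    by rewrite remE index_cat (negbTE vt) /= eqxx addn0 take_size_cat // -cat1s catA
       drop_size_cat ?cat_take_drop // size_cat addn1.
  move=> e; have := del _ _ xV jV; rewrite e.
  by have [-> ->] := del _ _ yV kV => -[-> ->].
move=> w; apply/idP/allpairsPdep => [|[x [i [xV _ ->]]]].
  rewrite mem_permutations => wV; have vw : v \in w by rewrite (perm_mem wV) mem_head.
  exists (rem v w), (index v w); split.
  - rewrite mem_permutations -(perm_cons v); apply: perm_trans wV.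
    by rewrite perm_sym perm_to_rem.
  - have : index v w < size w by rewrite index_mem.
    by rewrite mem_iota (perm_size wV).
  have iw : index v w < size w by rewrite index_mem.
  have st : size (take (index v w) w) = index v w by rewrite size_takel // ltnW.
  rewrite /insert remE take_size_cat // drop_size_cat //.
  by rewrite -[v in v :: _](nth_index v vw) -drop_nth // cat_take_drop.
move: xV; rewrite !mem_permutations => xV.
by rewrite /insert -(cat1s v (drop _ _)) perm_catCA cat1s perm_cons cat_take_drop.
Qed.

Lemma path_splice r a b x s : a \notin belast x s -> b \notin s ->
  path (splice r a b) x s = path r x s.
Proof.
elim: s x => //= y s IHs x; rewrite !inE !negb_or => /andP[ax asx] /andP[ay ays].
by rewrite IHs // /splice eq_sym (negbTE ax) eq_sym (negbTE ay).
Qed.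

(** By uniqueness the walk leaves [last x p1] and enters [b] only at the place of insertion, so no
    other arc is affected by the splice. *)
Lemma path_insert r v x p1 b p2 :
  uniq (belast x (p1 ++ b :: p2)) -> uniq (p1 ++ b :: p2) ->
  path r x (p1 ++ v :: b :: p2) =
  [&& r (last x p1) v, r v b & path (splice r (last x p1) b) x (p1 ++ b :: p2)].
Proof.
rewrite belast_cat !cat_uniq /= => /and3P[_ h1 /andP[h2 _]] /and3P[_ h3 /andP[h4 _]].
move: h1 h3; rewrite !negb_or => /andP[h1 _] /andP[h3 _].
rewrite !cat_path /= !path_splice // /splice !eqxx /=.
by rewrite andbCA (andbCA (path r x p1)).
Qed.

Lemma path_splice_next r x p1 c b p2 :
  path (splice r (last x p1) b) x (p1 ++ c :: p2) -> c = b.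
Proof. by rewrite cat_path /= /splice eqxx => /and3P[_ /andP[_ /eqP]]. Qed.

(** On a cycle with at least two vertices no vertex can follow itself. *)
Lemma ham_splice_diag r a V : a \in o :: V -> uniq (o :: V) -> V != [::] ->
  ham (splice r a a) V = 0.
Proof.
move=> aV /andP[oV uV] V0; apply/eqP; rewrite eqn0Ngt -has_count -all_predC.
apply/allP => w /=; rewrite mem_permutations => wV; apply/negP => pw.
have ow : o \notin w by rewrite (perm_mem wV).
have uw : uniq w by rewrite (perm_uniq wV).
have w0 : w != [::] by apply: contra V0 => /eqP w0; rewrite -size_eq0 -(perm_size wV) w0.
case: (eqVneq a o) aV pw => [-> _|ao].
  case: w wV ow uw w0 => // x w _; rewrite inE negb_or => /andP[ox _] _ _ pw.
  by move: ox; rewrite (@path_splice_next r o [::] x o (rcons w o) pw) eqxx.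
rewrite inE (negbTE ao) /= -(perm_mem wV) => aw.
case/path.splitP: aw ow uw => p1 p2; rewrite rcons_cat => _ + pw.
have [c [p3 ep]] : exists c, exists p3, rcons p2 o = c :: p3.
  by case: p2 {pw} => [|c p2]; [exists o, [::] | exists c, (rcons p2 o)].
rewrite cat_uniq => /and3P[_ /hasPn h _].
move: pw; rewrite ep => pw.
have := @path_splice_next r o (rcons p1 a) c a p3; rewrite last_rcons => /(_ pw) ca.
have : c \in rcons p2 o by rewrite ep mem_head.
rewrite ca mem_rcons inE (negbTE ao) /= => /h /=.
by rewrite mem_rcons mem_head.
Qed.

(* Removing v from a cyclic word joins its predecessor a to its successor b:
   the shorter word has a followed by b, and that pair determines where v was. *)
Lemma ham_elim r v V : uniq (o :: v :: V) ->
  ham r (v :: V) =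
  \sum_(a <- o :: V | r a v)
     \sum_(b <- o :: V | r v b && ((a != b) || (V == [::]))) ham (splice r a b) V.
Proof.
rewrite /= inE negb_or => /and3P[/andP[ov oV] vV uV].
have sum_w w : w \in permutations V ->
  \sum_(i <- iota 0 (size V).+1) path r o (rcons (insert v w i) o) =
  \sum_(a <- o :: V | r a v) \sum_(b <- o :: V | r v b) path (splice r a b) o (rcons w o).
  rewrite mem_permutations => wV; set p := rcons w o.
  have ub : uniq (belast o p) by rewrite belast_rcons /= (perm_mem wV) (perm_uniq wV) oV.
  have up : uniq p by rewrite rcons_uniq (perm_mem wV) (perm_uniq wV) oV.
  have pb : perm_eq (o :: V) (belast o p).
    by rewrite belast_rcons perm_cons perm_sym.
  have pp : perm_eq (o :: V) p by rewrite perm_sym perm_rcons perm_cons.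
  have sp : size p = (size V).+1 by rewrite size_rcons (perm_size wV).
  have sb : size (belast o p) = size p by rewrite size_belast.
  (* The sum over [a] is reindexed by position: inserting [v] at position [i] puts it between entry
     [i] of [o :: w] and entry [i] of [rcons w o]. *)
  rewrite (perm_big _ pb) (big_nth o) sb sp [RHS]big_mkcond /index_iota subn0.
  apply: eq_big_seq => i; rewrite mem_iota add0n ltnS /= => iV.
  have ip : i < size p by rewrite sp.
  have ep : p = take i p ++ nth o p i :: drop i.+1 p.
    by rewrite -drop_nth // cat_take_drop.
  have -> : rcons (insert v w i) o = take i p ++ v :: nth o p i :: drop i.+1 p.
    rewrite -drop_nth // /p /insert rcons_cat rcons_cons !drop_rcons ?(perm_size wV) //.
    by rewrite -(cats1 w) takel_cat // (perm_size wV).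
  have -> : nth o (belast o p) i = last o (take i p).
    rewrite {1}ep belast_cat nth_cat size_belast size_takel ?(ltnW ip) // ltnn subnn.
    by [].
  rewrite path_insert -?ep //; case: ifP => //= _.
  (* Only the actual successor of [a] in the word contributes, because the splice forces [b] to come
     right after [a]. *)
  rewrite (perm_big _ pp) /= big_mkcond /= (big_rem (nth o p i)) ?mem_nth //=.
  rewrite big1_seq ?addn0 => [|b]; first by case: (r v _).
  rewrite mem_rem_uniq // !inE => /and3P[_ bi _] /=; case: ifP => // _.
  case: (boolP (path _ _ _)) => //; rewrite {2}ep => /path_splice_next e.
  by rewrite -e eqxx in bi.
rewrite [LHS](permP (permutations_insert vV uV)) count_sum big_allpairs_dep.
rewrite (eq_big_seq _ sum_w) exchange_big /=.
rewrite [LHS]big_seq_cond [RHS]big_seq_cond; apply: eq_bigr => a /andP[aV _].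
rewrite exchange_big /= big_mkcondr /=; apply: eq_bigr => b _.
rewrite -(count_sum (fun w => path (splice r a b) o (rcons w o))) -/(ham _ _).
case: ifP => // /negbT; rewrite negb_or negbK => /andP[/eqP <- V0].
by rewrite ham_splice_diag //= oV.
Qed.

End Hamiltonian.

(** * Invariance under relabelling *)

Lemma permutations_map (T T' : eqType) (f : T -> T') (s : seq T) :
  injective f -> uniq s ->
  perm_eq (permutations (map f s)) (map (map f) (permutations s)).
Proof.
move=> f_inj s_uniq; apply: uniq_perm; first exact: permutations_uniq.
  by rewrite map_inj_uniq ?permutations_uniq //; exact: inj_map.
move=> t; rewrite mem_permutations; apply/idP/mapP => [|[t' + ->]]; last first.
  by rewrite mem_permutations; exact: perm_map.
case: s s_uniq => [|x s] s_uniq; first by move/perm_nilP ->; exists [::].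
case/(perm_iotaP (f x)) => js js_perm ->; rewrite size_map in js_perm.
exists [seq nth x (x :: s) j | j <- js].
  by rewrite mem_permutations; apply/(perm_iotaP x); exists js.
rewrite -map_comp; apply/eq_in_map => j; rewrite (perm_mem js_perm) mem_iota => jlt.
exact: (nth_map x).
Qed.

Lemma ham_map (T T' : eqType) (f : T -> T') (o : T)
    (r : rel T) (r' : rel T') (V : seq T) :
  injective f -> uniq V -> {in o :: V &, forall x y, r' (f x) (f y) = r x y} ->
  ham (f o) r' (map f V) = ham o r V.
Proof.
move=> f_inj V_uniq rr'; rewrite /ham (permP (permutations_map f_inj V_uniq)) count_map.
apply: eq_in_count => w; rewrite mem_permutations => /perm_mem wV /=.
rewrite -map_rcons path_map; apply: (@eq_in_path _ (mem (o :: V))) => //.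
by apply/allP => x; rewrite !inE mem_rcons inE wV orbA orbb.
Qed.

(** * Configurations of forced pairs on the grid of height 5 *)

(* A pair (a, b) in a state forces b to follow a.  The vertices not yet deleted
   are labelled 1, ..., m in column-major order, so that 1 is the next one to be
   deleted; 0 is the extra point, which may follow any vertex. *)
Definition state := seq (nat * nat).

(* Labels x < y.  The bottom row consists of the labels x with 5 %| m - x. *)
Definition grid_link (m x y : nat) : bool :=
  (y == x + 5) || (y == x.+1) && ((m - x) %% 5 != 0).

(** A tour may end anywhere, so every vertex may precede 0. No arc leads from 0 to a grid vertex:
    where a tour starts is imposed by a forced pair. *)
Definition base_rel (m : nat) : rel nat := fun x y =>
  (y == 0) || (x != 0) && (grid_link m x y || grid_link m y x).

Definition state_rel (m : nat) (F : state) : rel nat := fun x y =>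
  if (x \in unzip1 F) || (y \in unzip2 F) then (x, y) \in F
  else base_rel m x y.

Definition tours (m : nat) (F : state) : nat := ham 0 (state_rel m F) (iota 1 m).

(** The bound 5 is preserved by deletions: label 1 is joined to labels at most 6, which drop to at
    most 5. *)
Definition wf_state (F : state) : bool :=
  [&& uniq (unzip1 F), uniq (unzip2 F) & all (fun p => (p.1 <= 5) && (p.2 <= 5)) F].

Definition down (p : nat * nat) := (p.1.-1, p.2.-1).

(* Sorting gives each set of forced pairs a unique representative. *)
Definition contract (F : state) (a b : nat) : state :=
  sort (fun p q => p.1 <= q.1)
    (map down ((a, b) :: [seq p <- F | (p.1 != 1) && (p.2 != 1)])).

(* Here m vertices remain after the deletion, and 6 is the largest label that can
   be adjacent to 1 or occur in a forced pair with it. *)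
Definition step (m : nat) (F : state) : seq state :=
  let c := [seq x <- [:: 0; 2; 3; 4; 5; 6] | x <= m.+1] in
  let A := [seq a <- c | state_rel m.+1 F a 1] in
  let B := [seq b <- c | state_rel m.+1 F 1 b] in
  flatten [seq [seq contract F a b | b <- B & (a != b) || (m == 0)] | a <- A].

(** Inverse to [predn] away from the deleted label 1; the extra point 0 stays fixed. *)
Definition up (x : nat) : nat := if x is x'.+1 then x'.+2 else 0.

Lemma up_inj : injective up.
Proof. by move=> [|x] [|y] //= [->]. Qed.

Lemma up_neq1 x : up x != 1.
Proof. by case: x. Qed.

Lemma mem_map_predn (s : seq nat) x : 1 \notin s -> (x \in map predn s) = (up x \in s).
Proof.
elim: s => //= y s IHs; rewrite !inE negb_or => /andP[y1 /IHs ->]; congr orb.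
by case: x y y1 {IHs} => [|x] [|[|y]].
Qed.

Lemma mem_map_down (F : state) x y :
  all (fun p => (p.1 != 1) && (p.2 != 1)) F ->
  ((x, y) \in map down F) = ((up x, up y) \in F).
Proof.
elim: F => //= -[a b] F IHF /andP[/andP[/= a1 b1] /IHF e]; rewrite !inE e; congr orb.
rewrite /down !xpair_eqE /= {IHF e}.
by case: x a a1 => [|x] [|[|a]]; case: y b b1 => [|y] [|[|b]].
Qed.

Lemma unzip1_functional (F : state) x y z :
  uniq (unzip1 F) -> (x, y) \in F -> (x, z) \in F -> y = z.
Proof.
elim: F => //= -[a b] F IHF /andP[/= aF uF]; rewrite !inE !xpair_eqE.
case: eqP => [->|_] /=; last exact: IHF.
have nF w : ((a, w) \in F) = false by apply: contraNF aF => /(map_f fst).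
by rewrite !nF !orbF => /eqP -> /eqP ->.
Qed.

Lemma unzip2_functional (F : state) x y z :
  uniq (unzip2 F) -> (x, z) \in F -> (y, z) \in F -> x = y.
Proof.
elim: F => //= -[a b] F IHF /andP[/= bF uF]; rewrite !inE !xpair_eqE.
case: (eqVneq z b) => [->|_]; rewrite ?andbT ?andbF /=; last exact: IHF.
have nF w : ((w, b) \in F) = false by apply: contraNF bF => /(map_f snd).
by rewrite !nF !orbF => /eqP -> /eqP ->.
Qed.

Lemma mem_unzip1P (F : state) x : reflect (exists y, (x, y) \in F) (x \in unzip1 F).
Proof.
by apply: (iffP mapP) => [[[a b] ab ->]|[y xy]]; [exists b | exists (x, y)].
Qed.

Lemma mem_unzip2P (F : state) y : reflect (exists x, (x, y) \in F) (y \in unzip2 F).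
Proof.
by apply: (iffP mapP) => [[[a b] ab ->]|[x xy]]; [exists a | exists (x, y)].
Qed.

(** Rows are read off from [m - x], the distance to the last label, which deleting the first vertex
    does not change. *)
Lemma base_rel_up m x y : base_rel m.+1 (up x) (up y) = base_rel m x y.
Proof.
by case: x y => [|x] [|y] //; rewrite /base_rel /grid_link /= !subSS !addSn !eqSS.
Qed.

(** The pairs of [F] through 1 may be dropped: a forced predecessor or successor of 1 must be [a] or
    [b], and the new pair takes over its constraint. *)
Lemma splice_contract m F a b x y :
  wf_state F -> a != 1 -> b != 1 ->
  state_rel m.+1 F a 1 -> state_rel m.+1 F 1 b ->
  splice (state_rel m.+1 F) a b (up x) (up y) = state_rel m (contract F a b) x y.
Proof.
case/and3P => u1 u2 _ a1 b1 ra rb; rewrite /splice /state_rel /contract.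
set G := filter _ F; set s := sort _ _.
have ps : perm_eq s (map down ((a, b) :: G)) by rewrite /s perm_sort.
have G1 : all (fun p => (p.1 != 1) && (p.2 != 1)) ((a, b) :: G).
  by rewrite /= a1 b1 filter_all.
have GF z t : z != 1 -> t != 1 -> ((z, t) \in G) = ((z, t) \in F).
  by move=> z1 t1; rewrite mem_filter /= z1 t1.
rewrite (perm_mem ps) mem_map_down //.
rewrite (perm_mem (perm_map fst ps)) (perm_mem (perm_map snd ps)) -!map_comp.
rewrite (eq_map (g := predn \o fst)) //
  (eq_map (f := snd \o down) (g := predn \o snd)) // !map_comp.
rewrite !mem_map_predn; last first.
- by apply/mapP => -[p /(allP G1) /andP[p1 _] e]; rewrite -e in p1.
- by apply/mapP => -[p /(allP G1) /andP[_ p1] e]; rewrite -e in p1.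
rewrite -(base_rel_up m x y).
move: (up x) (up y) (up_neq1 x) (up_neq1 y) => {x y} x y x1 y1.
rewrite /= !inE xpair_eqE GF //.
case: (eqVneq x a) => [->|xa]; case: (eqVneq y b) => [->|yb] //=.
(* If [F] forced [y] after [a], then [a] could not be followed by 1, as [y] differs from 1. *)
- apply/esym/negP => ayF; move: ra.
  rewrite /state_rel (introT (mem_unzip1P _ _)); last by exists y.
  by move=> a1F; move: y1; rewrite (unzip1_functional u1 ayF a1F).
- rewrite orbT; apply/esym/negP => xbF; move: rb.
  rewrite /state_rel (introT (mem_unzip2P F b)) ?orbT; last by exists x.
  by move=> b1F; move: x1; rewrite (unzip2_functional u2 xbF b1F).
(* The only pair from [x] that the filter could drop is (x, 1), and then [ra] forces x = a. *)
have -> : (x \in unzip1 G) = (x \in unzip1 F).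
  apply/mem_unzip1P/mem_unzip1P => -[z].
    by rewrite mem_filter => /andP[_ ?]; exists z.
  move=> xzF; exists z; rewrite GF //; apply: contra xa => /eqP z1; rewrite {}z1 in xzF.
  move: ra; rewrite /state_rel (introT (mem_unzip2P F 1)) ?orbT; last by exists x.
  by move=> /(unzip2_functional u2 xzF) ->.
suff -> : (y \in unzip2 G) = (y \in unzip2 F) by [].
apply/mem_unzip2P/mem_unzip2P => -[z].
  by rewrite mem_filter => /andP[_ ?]; exists z.
move=> zyF; exists z; rewrite GF //; apply: contra yb => /eqP z1; rewrite {}z1 in zyF.
move: rb; rewrite /state_rel (introT (mem_unzip1P F 1)) //; last by exists y.
by move=> /(unzip1_functional u1 zyF) ->.
Qed.

Lemma ham_contract m F a b :
  wf_state F -> a != 1 -> b != 1 ->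
  state_rel m.+1 F a 1 -> state_rel m.+1 F 1 b ->
  ham 0 (splice (state_rel m.+1 F) a b) (iota 2 m) = tours m (contract F a b).
Proof.
move=> wF a1 b1 ra rb.
have -> : iota 2 m = map up (iota 1 m).
  by rewrite (iotaDl 1 1 m); apply/eq_in_map => -[|x]; rewrite ?mem_iota.
apply: (@ham_map _ _ up 0); [exact: up_inj | exact: iota_uniq |].
by move=> x y _ _; exact: splice_contract.
Qed.

Lemma state_rel_to1_le m F a : wf_state F -> state_rel m.+1 F a 1 -> a <= 6.
Proof.
case/and3P => _ _ /allP F5; rewrite /state_rel; case: ifP => [_ /F5 /=|_]; first lia.
by rewrite /base_rel /grid_link; lia.
Qed.

Lemma state_rel_from1_le m F b : wf_state F -> state_rel m.+1 F 1 b -> b <= 6.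
Proof.
case/and3P => _ _ /allP F5; rewrite /state_rel; case: ifP => [_ /F5 /=|_]; first lia.
by rewrite /base_rel /grid_link; lia.
Qed.

Lemma tours_step m F : wf_state F ->
  tours m.+1 F = \sum_(F' <- step m F) tours m F'.
Proof.
move=> wF; rewrite /tours -[iota 1 m.+1]/(1 :: iota 2 m) ham_elim; last first.
  by rewrite -[0 :: 1 :: _]/(iota 0 m.+2) iota_uniq.
rewrite /step big_flatten big_map.
set c := [seq x <- [:: 0; 2; 3; 4; 5; 6] | x <= m.+1].
have c_uniq : uniq c by rewrite filter_uniq.
have : uniq (0 :: iota 2 m) by rewrite /= mem_iota iota_uniq.
(* All candidates for [a] and [b] have label at most 6, so the sums over all remaining vertices
   reduce to sums over [c]. *)
have cP x : x <= 6 -> (x \in 0 :: iota 2 m) = (x \in c).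
  by move=> x6; rewrite mem_filter !inE mem_iota; lia.
have c1 x : x \in c -> x != 1 by rewrite mem_filter !inE; lia.
have -> : (iota 2 m == [::]) = (m == 0) by case: (m).
move: c (0 :: iota 2 m) c_uniq cP c1 => c U c_uniq cP c1 U_uniq.
rewrite -[LHS]big_filter (perm_big [seq a <- c | state_rel m.+1 F a 1]) /=; last first.
  apply: uniq_perm; rewrite ?filter_uniq // => x; rewrite !mem_filter.
  by case: (boolP (state_rel _ _ _ _)) => // /state_rel_to1_le -/(_ wF) /cP ->.
rewrite big_seq_cond [RHS]big_seq_cond; apply: eq_bigr => a; rewrite andbT mem_filter.
case/andP => ra /c1 a1.
rewrite big_map !big_filter big_filter_cond -[LHS]big_filter.
rewrite (perm_big [seq b <- c | state_rel m.+1 F 1 b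
                              && ((a != b) || (m == 0))]) /=; last first.
  apply: uniq_perm; rewrite ?filter_uniq // => x; rewrite !mem_filter.
  by case: (boolP (state_rel _ _ _ _)) => // /state_rel_from1_le -/(_ wF) /cP ->.
rewrite big_filter [LHS]big_seq_cond [RHS]big_seq_cond; apply: eq_bigr => b.
case/and3P => /c1 b1 rb _; exact: ham_contract.
Qed.

Lemma wf_contract m F a b : wf_state F -> a != 1 -> b != 1 -> a <= 6 -> b <= 6 ->
  state_rel m.+1 F a 1 -> state_rel m.+1 F 1 b -> wf_state (contract F a b).
Proof.
case/and3P => u1 u2 /allP F5 a1 b1 a6 b6 ra rb; rewrite /wf_state /contract.
set G := filter _ F; set s := sort _ _.
have ps : perm_eq s (map down ((a, b) :: G)) by rewrite /s perm_sort.
rewrite (perm_uniq (perm_map fst ps)) (perm_uniq (perm_map snd ps)) (perm_all _ ps).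
rewrite -!map_comp (eq_map (g := predn \o fst)) //
  (eq_map (f := snd \o down) (g := predn \o snd)) // !map_comp.
have pred_inj (t : seq nat) : 1 \notin t -> uniq (map predn t) = uniq t.
  move=> t1; apply: map_inj_in_uniq => x y xt yt.
  have : x != 1 by apply: contraNN t1 => /eqP <-.
  have : y != 1 by apply: contraNN t1 => /eqP <-.
  by lia.
have G1 : all (fun p => (p.1 != 1) && (p.2 != 1)) ((a, b) :: G).
  by rewrite /= a1 b1 filter_all.
rewrite !pred_inj; last first.
- by apply/mapP => -[p /(allP G1) /andP[p1 _] e]; rewrite -e in p1.
- by apply/mapP => -[p /(allP G1) /andP[_ p1] e]; rewrite -e in p1.
apply/and3P; split => /=.
- rewrite (subseq_uniq _ u1) ?andbT; last by apply: map_subseq; exact: filter_subseq.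
  apply/mem_unzip1P => -[z]; rewrite mem_filter /= => /andP[/andP[_ z1] azF].
  move: ra; rewrite /state_rel (introT (mem_unzip1P F a)); last by exists z.
  by move=> /(unzip1_functional u1 azF) e; rewrite e in z1.
- rewrite (subseq_uniq _ u2) ?andbT; last by apply: map_subseq; exact: filter_subseq.
  apply/mem_unzip2P => -[z]; rewrite mem_filter /= => /andP[/andP[z1 _] zbF].
  move: rb; rewrite /state_rel (introT (mem_unzip2P F b)) ?orbT; last by exists z.
  by move=> /(unzip2_functional u2 zbF) e; rewrite e in z1.
have -> : (a.-1 <= 5) && (b.-1 <= 5) by lia.
apply/allP => _ /mapP[p + ->]; rewrite mem_filter => /andP[_ /F5 /=]; lia.
Qed.

Lemma wf_step m F : wf_state F -> all wf_state (step m F).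
Proof.
move=> wF; apply/allP => _ /flatten_mapP[a + /mapP[b + ->]].
rewrite !mem_filter => /and3P[ra _ ac] /and4P[_ rb _ bc].
apply: (wf_contract (m := m)) => //.
- by move: ac; rewrite !inE; lia.
- by move: bc; rewrite !inE; lia.
- exact: state_rel_to1_le ra.
- exact: state_rel_from1_le rb.
Qed.

(* For labels up to m.+1 the grid relation depends on m only modulo 5. *)
Lemma step_periodic m F : 5 <= m -> step (m + 5) F = step m F.
Proof.
move=> m5; rewrite /step; have -> : (m + 5 == 0) = (m == 0) by lia.
have c_all k : 5 <= k ->
    [seq x <- [:: 0; 2; 3; 4; 5; 6] | x <= k.+1] = [:: 0; 2; 3; 4; 5; 6].
  by move=> k5; apply/all_filterP/allP => x; rewrite !inE; lia.
rewrite !c_all; [|lia|lia].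
have rE x y : x <= 6 -> y <= 6 -> state_rel (m + 5).+1 F x y = state_rel m.+1 F x y.
  move=> x6 y6; rewrite /state_rel; case: ifP => // _.
  by rewrite /base_rel /grid_link; lia.
congr flatten.
rewrite (eq_in_filter (a1 := fun a => state_rel (m + 5).+1 F a 1)
  (a2 := fun a => state_rel m.+1 F a 1)); last first.
  by move=> a; rewrite !inE => ac; apply: rE; lia.
rewrite (eq_in_filter (a1 := fun b => state_rel (m + 5).+1 F 1 b)
  (a2 := fun b => state_rel m.+1 F 1 b)) //.
by move=> a; rewrite !inE => ac; apply: rE; lia.
Qed.

(** * Tours as cyclic words *)

Section Grid.
Variable n : nat.
Let V : finType := vertex 5 n.

Definition label (v : V) : nat := (5 * v.2 + v.1).+1.

Lemma label_inj : injective label.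
Proof.
move=> [i j] [i' j']; rewrite /label /= => e.
have := ltn_ord i; have := ltn_ord i' => lt lt'.
by congr pair; apply: val_inj => /=; lia.
Qed.

Lemma perm_label : perm_eq (map label (enum V)) (iota 1 (5 * n)).
Proof.
have u : uniq (map label (enum V)) by rewrite (map_inj_uniq label_inj) enum_uniq.
apply: uniq_perm => //; first exact: iota_uniq.
apply: (uniq_min_size u _ _).2.
  move=> _ /mapP[[i j] _ ->]; rewrite mem_iota /label /=.
  by have := ltn_ord i; have := ltn_ord j; lia.
by rewrite size_iota size_map -cardE card_prod !card_ord.
Qed.

Lemma adj_label (u v : V) :
  adj u v = grid_link (5 * n) (label u) (label v)
            || grid_link (5 * n) (label v) (label u).
Proof.
case: u v => [i j] [i' j']; rewrite /adj /grid_link /label /=.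
have := ltn_ord j; have := ltn_ord j'; have := ltn_ord i; have := ltn_ord i'.
move: (i : nat) (j : nat) (i' : nat) (j' : nat) => {i j i' j'} a b c d a5 c5 dn bn.
(* This residue vanishes exactly in the bottom row [a = 4], where the next label begins a new
   column. *)
have -> : (5 * n - (5 * b + a).+1) %% 5 = 4 - a by lia.
have -> : (5 * n - (5 * d + c).+1) %% 5 = 4 - c by lia.
have sq (x y : nat) : (x ^ 2 + y ^ 2 == 1) = (x == 0) && (y == 1) || (x == 1) && (y == 0).
  by move: x y => [|[|x]] [|[|y]] //; rewrite -?mulnn; nia.
rewrite sq; lia.
Qed.

(** The forced pair (0, 1) makes the cycle enter the grid at the upper-left corner, while the return
    to 0 is free. *)
Lemma greek_key_tour_path (w : seq V) : perm_eq w (enum V) ->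
  greek_key_tour w =
  path (state_rel (5 * n) [:: (0, 1)]) 0 (rcons (map label w) 0).
Proof.
move=> wV.
have w_uniq : uniq w by rewrite (perm_uniq wV) enum_uniq.
have once : [forall u : V, count_mem u w == 1].
  by apply/forallP => u; rewrite count_uniq_mem // (perm_mem wV) mem_enum.
case: w w_uniq once {wV} => [|v w] //= /andP[vw _] ->; rewrite andbT.
have r0 x : state_rel (5 * n) [:: (0, 1)] 0 x = (x == 1).
  by rewrite /state_rel !inE eqxx.
have r1 x y : x != 0 -> y != 1 ->
    state_rel (5 * n) [:: (0, 1)] x y = base_rel (5 * n) x y.
  by move=> x0 y1; rewrite /state_rel !inE (negbTE x0) (negbTE y1).
rewrite r0; have -> : upper_left v = (label v == 1).
  by rewrite /upper_left /label eqSS addn_eq0 muln_eq0 /= andbC.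
case: eqP => //= lv1; rewrite rcons_path last_map r1 // andbT {r0}.
(* No later vertex has label 1, so past the corner the forced pair plays no part and only adjacency
   is tested. *)
elim: w {2 3}v vw => //= y w IHw x; rewrite inE negb_or => /andP[vy vw].
rewrite (IHw y vw) adj_label r1 //.
by rewrite -lv1 (inj_eq label_inj) eq_sym.
Qed.

Lemma greek_key_tour_perm (w : seq V) : greek_key_tour w -> perm_eq w (enum V).
Proof.
case: w => // v w /and3P[_ _ /forallP once].
apply: uniq_perm; [|exact: enum_uniq|] => [|u].
  apply: count_mem_uniq => u; rewrite (eqP (once u)).
  by rewrite -has_pred1 has_count (eqP (once u)).
by rewrite mem_enum -has_pred1 has_count (eqP (once u)).
Qed.

(** For [n = 0] the two sides differ: the convention gives 1, but no closed walk obeys the pair (0,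
    1) on an empty grid. *)
Lemma greek_key_numberE : 0 < n -> greek_key_number 5 n = tours (5 * n) [:: (0, 1)].
Proof.
move=> n_gt0; rewrite /greek_key_number ifF ?gtn_eqF //.
set G := [set w : _.-tuple _ | _].
have GE : perm_eq (map val (enum G)) [seq w <- permutations (enum V) | greek_key_tour w].
  apply: uniq_perm.
  - by rewrite map_inj_uniq ?enum_uniq //; exact: val_inj.
  - by rewrite filter_uniq // permutations_uniq.
  move=> w; rewrite mem_filter mem_permutations; apply/mapP/andP => [[t + ->]|[gw wV]].
    by rewrite mem_enum inE => gt; split=> //; exact: greek_key_tour_perm.
  have sw : size w == 5 * n by rewrite (greek_key_tour_size gw).
  by exists (Tuple sw); rewrite // mem_enum inE.
rewrite cardE -(size_map val) (perm_size GE) size_filter.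
rewrite /tours -(ham_perm _ _ perm_label) /ham.
rewrite (permP (permutations_map label_inj (enum_uniq _))) count_map.
apply: eq_in_count => w; rewrite mem_permutations.
exact: greek_key_tour_path.
Qed.

End Grid.

(** * Integral combinations of configurations *)

Local Open Scope ring_scope.

Definition ratZ (z : Z) : rat := (int_of_Z z)%:~R.

Lemma ratZD x y : ratZ (Z.add x y) = ratZ x + ratZ y.
Proof. by rewrite /ratZ -[Z.add x y]/(x + y) !rmorphD. Qed.

Lemma ratZM x y : ratZ (Z.mul x y) = ratZ x * ratZ y.
Proof. by rewrite /ratZ -[Z.mul x y]/(x * y) !rmorphM. Qed.

Lemma ratZ0 : ratZ Z0 = 0. Proof. by []. Qed.

Definition comb := seq (state * Z).

Definition step_comb (m : nat) (L : comb) : comb :=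
  flatten [seq [seq (F, p.2) | F <- step m p.1] | p <- L].

Fixpoint add_term (p : state * Z) (L : comb) : comb :=
  if L is q :: L' then
    if p.1 == q.1 then (q.1, Z.add p.2 q.2) :: L' else q :: add_term p L'
  else [:: p].

Definition collect (L : comb) : comb :=
  [seq p <- foldr add_term [::] L | ~~ Z.eqb p.2 Z0].

(** By periodicity the indices 9 down to 5, applied in that order by [foldr], serve for every column
    except the last. *)
Definition column (L : comb) : comb := collect (foldr step_comb L (iota 5 5)).

(** Near the end the true indices 4 down to 0 are used; afterwards only the extra point is left, and
    a state counts 1 if its loop is allowed. *)
Definition last_column (L : comb) : Z :=
  foldr (fun p z => if state_rel 0 p.1 0 0 then Z.add p.2 z else z) Z0
    (foldr step_comb L (iota 0 5)).

Definition lin_comb (cs : seq Z) (Ls : seq comb) : comb :=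
  collect (flatten [seq [seq (q.1, Z.mul p.1 q.2) | q <- p.2] | p <- zip cs Ls]).

Definition value (m : nat) (L : comb) : rat :=
  \sum_(p <- L) ratZ p.2 * (tours m p.1)%:R.
Arguments value m%_N L.

Definition wf_comb (L : comb) : bool := all (fun p => wf_state p.1) L.

Arguments step m%_N F.
Arguments tours m%_N F.

Lemma wf_step_comb m L : wf_comb L -> wf_comb (step_comb m L).
Proof.
move=> /allP wL; apply/allP => _ /flatten_mapP[p /wL wp /mapP[F FS ->]] /=.
exact: (allP (wf_step m wp)).
Qed.

Lemma wf_collect L : wf_comb L -> wf_comb (collect L).
Proof.
move=> wL; rewrite /wf_comb /collect all_filter.
apply: (@sub_all _ (fun p => wf_state p.1)) => [p /= -> | ]; first exact: implybT.
elim: L wL => //= p L IHL /andP[wp /IHL]; elim: (foldr _ _ _) => [|q L' IHL'] /=.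
  by rewrite wp.
by case/andP => wq wL'; case: ifP => _ /=; rewrite wq //= IHL'.
Qed.

Lemma wf_foldr_step L ms : wf_comb L -> wf_comb (foldr step_comb L ms).
Proof. by move=> wL; elim: ms => //= m ms; exact: wf_step_comb. Qed.

Lemma wf_column L : wf_comb L -> wf_comb (column L).
Proof. by move=> wL; apply/wf_collect/wf_foldr_step. Qed.

Lemma wf_iter_column L i : wf_comb L -> wf_comb (iter i column L).
Proof. by move=> wL; elim: i => //= i; exact: wf_column. Qed.

Lemma wf_lin_comb cs Ls : all wf_comb Ls -> wf_comb (lin_comb cs Ls).
Proof.
move=> wLs; apply: wf_collect.
apply/allP => _ /flatten_mapP[[c L] cL /mapP[p pL ->]] /=.
have LLs : L \in Ls.
  elim: cs Ls cL {wLs} => [|c' cs IHcs] [|L' Ls] //=; rewrite !inE xpair_eqE.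
  by case/orP => [/andP[_ ->] // | /IHcs ->]; rewrite orbT.
exact: (allP (allP wLs _ LLs)).
Qed.

Lemma value_step_comb m L : wf_comb L -> value m.+1 L = value m (step_comb m L).
Proof.
move=> wL; rewrite /value big_flatten /= big_map; apply: eq_big_seq => p pL.
rewrite big_map tours_step ?(allP wL) // natr_sum mulr_sumr.
by apply: eq_bigr.
Qed.

Lemma value_collect m L : value m (collect L) = value m L.
Proof.
rewrite /value /collect big_filter big_mkcond /=.
rewrite (eq_bigr (fun p => ratZ p.2 * (tours m p.1)%:R)) => [|p _]; last first.
  by case: ifP => // /negbFE /Z.eqb_eq ->; rewrite ratZ0 mul0r.
elim: L => [|p L IHL] //; rewrite [RHS]big_cons -{}IHL /=.
elim: (foldr _ _ _) => [|q L' IHL'] /=; first by rewrite big_seq1 big_nil addr0.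
case: eqP => [-> | _]; rewrite !big_cons; first by rewrite ratZD mulrDl addrA.
by rewrite IHL' addrCA.
Qed.

Lemma step_mod n m F : (5 <= m)%N -> step (5 * n + m) F = step m F.
Proof.
move=> m5; elim: n => // n IHn; rewrite -IHn.
rewrite -(step_periodic _ (m := 5 * n + m)); last by lia.
by congr step; lia.
Qed.

Lemma value_step_combs (n m k : nat) L : (5 <= m)%N -> wf_comb L ->
  value (5 * n + (m + k)) L = value (5 * n + m) (foldr step_comb L (iota m k)).
Proof.
move=> m5 wL; elim: k m m5 => [|k IHk] m m5 /=; first by rewrite addn0.
rewrite addnS -addSn IHk ?(leqW m5) // addnS value_step_comb; last exact: wf_foldr_step.
rewrite /step_comb; congr (value _ (flatten _)); apply: eq_map => p.
by rewrite step_mod.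
Qed.

Lemma value_column n L : wf_comb L ->
  value (5 * n.+2) L = value (5 * n.+1) (column L).
Proof.
move=> wL; rewrite /column value_collect.
have -> : (5 * n.+2 = 5 * n + (5 + 5))%N by lia.
by rewrite (value_step_combs n _ (leqnn 5)) // mulnSr.
Qed.

Lemma value_iter_column n i L : wf_comb L ->
  value (5 * n.+1) (iter i column L) = value (5 * (n + i).+1) L.
Proof.
move=> wL; elim: i n => [|i IHi] n; first by rewrite addn0.
by rewrite iterS -value_column ?wf_iter_column // IHi addSnnS.
Qed.

Lemma value_last_column L : wf_comb L -> value 5 L = ratZ (last_column L).
Proof.
move=> wL; rewrite /last_column.
do 5 (rewrite value_step_comb; last by do ?apply: wf_step_comb).
rewrite /= /value; elim: (step_comb 0 _) => [|p L' IHL']; first by rewrite big_nil.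
rewrite big_cons IHL' /= /tours /ham /=; case: ifP => _ /=.
  by rewrite ratZD mulr1.
by rewrite mulr0 add0r.
Qed.

Lemma value_lin_comb m cs Ls : size Ls = size cs ->
  value m (lin_comb cs Ls) =
  \sum_(i < size cs) ratZ (nth Z0 cs i) * value m (nth [::] Ls i).
Proof.
rewrite value_collect; elim: cs Ls => [|c cs IHcs] [|L Ls] //= => [_|[sz]].
  by rewrite /value big_nil big_ord0.
rewrite big_ord_recl -IHcs // /value /= big_cat /= big_map mulr_sumr; congr +%R.
by apply: eq_bigr => p _; rewrite ratZM mulrA.
Qed.

Lemma value_lin_comb_columns n cs L : wf_comb L ->
  value (5 * n.+1) (lin_comb cs (traject column L (size cs))) =
  \sum_(i < size cs) ratZ (nth Z0 cs i) * value (5 * (n + i).+1) L.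
Proof.
move=> wL; rewrite value_lin_comb ?size_traject //; apply: eq_bigr => i _.
by rewrite (set_nth_default L) ?size_traject // nth_traject // value_iter_column.
Qed.

(** The recurrence is monic, so each term is determined by the [d] terms before it. *)
Lemma linear_recurrence_eq0 (R : pzRingType) (d : nat) (c s : nat -> R) :
  c d = 1 -> (forall n, \sum_(i < d.+1) c i * s (n + i)%N = 0) ->
  (forall i, (i < d)%N -> s i = 0) -> forall n, s n = 0.
Proof.
move=> cd rec s0; elim/ltn_ind => n IHn; case: (ltnP n d) => [/s0 // | dn].
have := rec (n - d)%N; rewrite big_ord_recr /= cd mul1r subnK // big1 ?add0r // => i _.
by rewrite IHn ?mulr0 //; have := ltn_ord i; lia.
Qed.

(** * Explicit coefficients and the finite certificate *)

Section Coefficients.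
Local Open Scope Z_scope.

Definition start : comb := [:: ([:: (0, 1)%N], 1)].

Definition numerator : seq Z :=
  [:: 1; -3; -13; 58; 25; -162; 63; 113; -61; 12; -11; 25; -17; 5; -3].

Definition denominator : seq Z :=
  [:: 1; -4; -14; 54; 33; -117; -2; 84; 6; -9; 0; 14; 0; 2].

(* Ascending coefficients of a polynomial that annihilates column denominator_comb,
   found by Gaussian elimination on its iterates under column. *)
Definition annihilator : seq Z :=
  [:: 0; 0; 0; 0; 27; 27; -162; 108; 144; -315; 89; 260; -157; -95; 72; 16; -14; -1; 1].

End Coefficients.

(** The values for 0 to 14 columns; the leading 1 is the convention for the empty grid. *)
Definition first_terms : seq Z :=
  Zpos xH :: map last_column (traject column start 14).

(** The reversal pairs coefficient [13 - i] of Q with the [i]-th iterate, so the value at [5 * n.+1]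
    is the coefficient of x^(n+14) in Q G_5. *)
Definition denominator_comb : comb :=
  lin_comb (rev denominator) (traject column start 14).

Definition convolution (s t : seq Z) (n : nat) : Z :=
  foldr (fun i z => Z.add (Z.mul (nth Z0 s i) (nth Z0 t (n - i))) z) Z0 (iota 0 n.+1).

Lemma first_termsE :
  map (convolution first_terms denominator) (iota 0 15) = numerator.
Proof. by vm_compute. Qed.

(** The extra [column] moves the orbit past the coefficient of x^14, which is -3; the values tested
    are the coefficients of x^15 to x^33. *)
Definition certificate : bool :=
  let Ls := traject column (column denominator_comb) 19 in
  all (fun L => Z.eqb (last_column L) Z0) Ls && nilp (lin_comb annihilator Ls).

Lemma certificateT : certificate.
Proof. by vm_compute. Qed.

Lemma wf_denominator_comb : wf_comb denominator_comb.
Proof.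
apply: wf_lin_comb; apply/allP => _ /trajectP[i _ ->]; exact: wf_iter_column.
Qed.

Lemma denominator_comb_eq0 n : value (5 * n.+1) (column denominator_comb) = 0.
Proof.
have := wf_column wf_denominator_comb; have := certificateT.
rewrite /certificate.
move: (column denominator_comb) => Y /andP[/allP last0 /nilP ann0] wf.
(* Applying the annihilating polynomial to the orbit gives a recurrence of order 18 with leading
   coefficient 1. *)
apply: (@linear_recurrence_eq0 _ 18 (fun i => ratZ (nth Z0 annihilator i))
          (fun n => value (5 * n.+1) Y)) => [//|k|i lti].
  by rewrite -(value_lin_comb_columns k annihilator wf) ann0 /value big_nil.
have := value_iter_column 0%N i wf; rewrite add0n => <-.
rewrite value_last_column ?wf_iter_column //.
have /last0 : iter i column Y \in traject column Y 19.
  by apply/trajectP; exists i => //; lia.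
by move=> /Z.eqb_eq ->.
Qed.

(** * From the recurrence to the power series identity *)

Lemma greek_key_gf_start n : greek_key_gf 5 n.+1 = value (5 * n.+1) start.
Proof. by rewrite /greek_key_gf greek_key_numberE // /value big_seq1 mul1r. Qed.

(** This is the coefficient of x^(n+15) in Q G_5. *)
Lemma greek_key_gf_rec n :
  \sum_(i < 14) greek_key_gf 5 (n + 2 + i) * ratZ (nth Z0 denominator (13 - i)) = 0.
Proof.
rewrite -[RHS](denominator_comb_eq0 n) -value_column ?wf_denominator_comb //.
rewrite (value_lin_comb_columns n.+1 (rev denominator) (isT : wf_comb start)).
apply: eq_bigr => i _; rewrite mulrC nth_rev; last exact: (ltn_ord i).
rewrite subSS.
by rewrite addn2 !addSn -greek_key_gf_start.
Qed.

Lemma greek_key_gf_first i : (i < 15)%N -> greek_key_gf 5 i = ratZ (nth Z0 first_terms i).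
Proof.
case: i => [|i] // lti.
rewrite -[nth _ _ _]/(nth Z0 (map last_column (traject column start 14)) i).
rewrite (nth_map start) ?size_traject // nth_traject //.
rewrite -value_last_column ?wf_iter_column // (value_iter_column 0) //.
by rewrite greek_key_gf_start.
Qed.

Lemma ratZ_convolution s t n :
  ratZ (convolution s t n) = \sum_(i < n.+1) ratZ (nth Z0 s i) * ratZ (nth Z0 t (n - i)).
Proof.
rewrite -(big_mkord xpredT (fun i => ratZ (nth Z0 s i) * ratZ (nth Z0 t (n - i)))).
rewrite /convolution /index_iota subn0.
elim: (iota _ _) => [|i r IHr]; first by rewrite big_nil.
by rewrite big_cons /= ratZD ratZM IHr.
Qed.

Lemma coef_Poly_ratZ (s : seq Z) i : (Poly (map ratZ s))`_i = ratZ (nth Z0 s i).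
Proof.
rewrite coef_Poly; case: (ltnP i (size s)) => [lti | lei]; first exact: nth_map.
by rewrite !nth_default ?size_map.
Qed.

Lemma greek_key_gf_mul :
  fps_mul (greek_key_gf 5) (fps_of_poly (Poly (map ratZ denominator)))
    =1 fps_of_poly (Poly (map ratZ numerator)).
Proof.
move=> n; rewrite /fps_mul /fps_of_poly coef_Poly_ratZ.
under eq_bigr => i _ do rewrite coef_Poly_ratZ.
case: (ltnP n 15) => [ltn | len].
  rewrite -first_termsE (nth_map 0%N) ?size_iota // nth_iota // ratZ_convolution.
  by apply: eq_bigr => i _; rewrite greek_key_gf_first //; have := ltn_ord i; lia.
rewrite [RHS](_ : _ = 0) ?nth_default //.
(* Q has degree 13, so only the last 14 terms of the convolution survive; the earlier ones meet the
   default coefficient 0. *)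
have -> : (n.+1 = (n - 15 + 2) + 14)%N by lia.
rewrite big_split_ord /= big1 ?add0r => [|i _].
  rewrite -[RHS](greek_key_gf_rec (n - 15)); apply: eq_bigr => i _.
  by congr (_ * ratZ (nth _ _ _)); have := ltn_ord i; lia.
rewrite [nth _ _ _]nth_default ?ratZ0 ?mulr0 //=.
by have := ltn_ord i; lia.
Qed.

Lemma ratZ_numerator :
  map ratZ numerator =
    [:: 1; -3; -13; 58; 25; -162; 63; 113; -61; 12; -11; 25; -17; 5; -3].
Proof. by apply/eqP; vm_compute. Qed.

Lemma ratZ_denominator :
  map ratZ denominator = [:: 1; -4; -14; 54; 33; -117; -2; 84; 6; -9; 0; 14; 0; 2].
Proof. by apply/eqP; vm_compute. Qed.

Theorem mainTheorem10 :
  let P : {poly rat} :=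
    1 - 3 *: 'X - 13 *: 'X^2 + 58 *: 'X^3 + 25 *: 'X^4 - 162 *: 'X^5
    + 63 *: 'X^6 + 113 *: 'X^7 - 61 *: 'X^8 + 12 *: 'X^9 - 11 *: 'X^10
    + 25 *: 'X^11 - 17 *: 'X^12 + 5 *: 'X^13 - 3 *: 'X^14 in
  let Q : {poly rat} :=
    (1 + 'X) * (1 - 11 *: 'X^2 - 2 *: 'X^6)
    * (1 - 5 *: 'X + 2 *: 'X^2 + 8 *: 'X^3 - 8 *: 'X^4 + 'X^5 - 'X^6) in
  greek_key_gf 5 =1 fps_div (fps_of_poly P) (fps_of_poly Q).
Proof.
move=> P Q.
have -> : P = Poly (map ratZ numerator).
  by rewrite ratZ_numerator /P /= !cons_poly_def -!mul_polyC; ring.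
have -> : Q = Poly (map ratZ denominator).
  by rewrite ratZ_denominator /Q /= !cons_poly_def -!mul_polyC; ring.
(* Division may be cleared because the constant coefficient of Q is 1. *)
apply/fps_divP; last exact: greek_key_gf_mul.
by rewrite /fps_of_poly coef_Poly_ratZ.
Qed.
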